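(* Let $\mathcal{E}$ and $\mathcal{E}'$ be two concentric ellipses in the Euclidean plane (with axes aligned or not) with common center $O$, where $\mathcal{E}'$ (the inner ellipse) lies in the interior of $\mathcal{E}$ (the outer ellipse), and suppose that the pair $(\mathcal{E},\mathcal{E}')$ admits a Poncelet 3-periodic family, i.e. a one-parameter family of triangles inscribed in $\mathcal{E}$ and circumscribed about $\mathcal{E}'$. For a triangle $P_1P_2P_3$ of this family, let $P_1',P_2',P_3'$ be the vertices of its anticevian triangle with respect to $O$, let $\mathcal{C}_i'$ be the circumellipse of $P_1P_2P_3$ centered at $P_i'$, let $\Delta_i$ be the area of $\mathcal{C}_i'$, and let $\Sigma_O=\Delta_1+\Delta_2+\Delta_3$. Then $\Sigma_O$ is invariant over the family: it takes the same value for every triangle of the 3-periodic family.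
   Context: A Poncelet 3-periodic family of $(\mathcal{E},\mathcal{E}')$: every point of $\mathcal{E}$ is a vertex of a triangle whose three vertices lie on $\mathcal{E}$ and whose three sides are tangent to $\mathcal{E}'$; the family is the set of all such triangles. Trilinear coordinates $[u:v:w]$ of a point with respect to a triangle $P_1P_2P_3$ are its signed distances, up to a common factor, to the side lines opposite $P_1,P_2,P_3$ respectively (positive on the side of the line containing the triangle). The anticevian triangle of $P_1P_2P_3$ with respect to a point with trilinears $[u:v:w]$ has vertices $P_1'=[-u:v:w]$, $P_2'=[u:-v:w]$, $P_3'=[u:v:-w]$. A circumellipse of a triangle is an ellipse passing through its three vertices; the circumellipse centered at a given point is the one having that point as its center. *)

(* Defs.v *)
From HB Require Import structures.
From mathcomp Require Import all_boot all_order all_algebra.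
From mathcomp Require Import all_classical all_reals all_analysis.

Set Implicit Arguments.
Unset Strict Implicit.
Unset Printing Implicit Defensive.

Import Order.TTheory GRing.Theory Num.Theory.

Local Open Scope classical_set_scope.
Local Open Scope ring_scope.

Section Plane.
Variable R : realType.

(* The norm the library puts on [R * R] is the sup norm, so the Euclidean
   distance is written out. *)
Definition eucl_dist (A B : R * R) : R :=
  Num.sqrt ((B.1 - A.1) ^+ 2 + (B.2 - A.2) ^+ 2).

(* Twice the signed area of the triangle ABC. *)
Definition orient (A B C : R * R) : R :=
  (B.1 - A.1) * (C.2 - A.2) - (B.2 - A.2) * (C.1 - A.1).

(* Meant for A <> B. *)
Definition line (A B : R * R) : set (R * R) := [set X | orient A B X = 0].

(* [eaxis] is the direction of the semi-axis of length [semi1]; no order is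
   imposed on the two semi-axes, and circles are included. *)
Record ellipse := Ellipse {
  ecenter : R * R;
  eaxis : R * R;
  semi1 : R;
  semi2 : R;
  eaxis_unit : eaxis.1 ^+ 2 + eaxis.2 ^+ 2 = 1;
  semi1_gt0 : 0 < semi1;
  semi2_gt0 : 0 < semi2 }.

(* The left-hand side of the equation x^2/a^2 + y^2/b^2 = 1, in the
   orthonormal frame given by the centre and the axes. *)
Definition ellipse_form (E : ellipse) (X : R * R) : R :=
  let dx := X.1 - (ecenter E).1 in
  let dy := X.2 - (ecenter E).2 in
  (((eaxis E).1 * dx + (eaxis E).2 * dy) / semi1 E) ^+ 2
  + (((eaxis E).1 * dy - (eaxis E).2 * dx) / semi2 E) ^+ 2.

Definition curve (E : ellipse) : set (R * R) := [set X | ellipse_form E X = 1].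
Definition inside (E : ellipse) : set (R * R) := [set X | ellipse_form E X < 1].
Definition region (E : ellipse) : set (R * R) :=
  [set X | ellipse_form E X <= 1].

Definition area (E : ellipse) : \bar R :=
  (@lebesgue_measure R \x @lebesgue_measure R)%E (region E).

(* For an ellipse, a line is tangent exactly when it meets the curve in a
   single point. *)
Definition tangent_to (L : set (R * R)) (E : ellipse) : Prop :=
  exists! X : R * R, L X /\ curve E X.

Definition poncelet_triangle (E E' : ellipse) (P1 P2 P3 : R * R) : Prop :=
  [/\ orient P1 P2 P3 != 0,
      [/\ curve E P1, curve E P2 & curve E P3] &
      [/\ tangent_to (line P2 P3) E', tangent_to (line P3 P1) E'
        & tangent_to (line P1 P2) E']].

Definition poncelet_3periodic (E E' : ellipse) : Prop :=
  forall P1 : R * R, curve E P1 ->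
    exists P2 P3 : R * R, poncelet_triangle E E' P1 P2 P3.

(* Signed distance from X to the line BC, positive on the side of A. *)
Definition sdist (A B C X : R * R) : R :=
  Num.sg (orient B C A) * orient B C X / eucl_dist B C.

Definition has_trilinears (P1 P2 P3 X : R * R) (u v w : R) : Prop :=
  exists2 k : R, k != 0 &
    [/\ sdist P1 P2 P3 X = k * u, sdist P2 P3 P1 X = k * v
      & sdist P3 P1 P2 X = k * w].

Definition is_anticevian (P1 P2 P3 O Q1 Q2 Q3 : R * R) : Prop :=
  exists u v w : R,
    [/\ has_trilinears P1 P2 P3 O u v w,
        has_trilinears P1 P2 P3 Q1 (- u) v w,
        has_trilinears P1 P2 P3 Q2 u (- v) w
      & has_trilinears P1 P2 P3 Q3 u v (- w)].

Definition is_circumellipse (P1 P2 P3 Q : R * R) (C : ellipse) : Prop :=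
  [/\ ecenter C = Q, curve C P1, curve C P2 & curve C P3].

Definition anticevian_circumellipses (P1 P2 P3 O : R * R)
    (C1 C2 C3 : ellipse) : Prop :=
  exists Q1 Q2 Q3 : R * R,
    [/\ is_anticevian P1 P2 P3 O Q1 Q2 Q3,
        is_circumellipse P1 P2 P3 Q1 C1,
        is_circumellipse P1 P2 P3 Q2 C2
      & is_circumellipse P1 P2 P3 Q3 C3].

End Plane.

(* Main.v *)
(* Let (a, b, c) be the barycentric coordinates of O, with a + b + c = 1, and put
   X = b + c - a, Y = c + a - b, Z = a + b - c, so X + Y + Z = 1; let o be twice
   the signed area of the triangle.  A circumellipse of semi-axes s, s' centred
   at the point of weights x, y, z satisfies
     (s s')^2 (x+y+z)^3 (y+z-x) (z+x-y) (x+y-z) = 4 x^2 y^2 z^2 o^2,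
   because x p1 + y p2 + z p3 = 0 for three unit vectors of the norm of the
   ellipse.  Applied to E (weights a, b, c; semi-axis product M) and to the three
   anticevian circumellipses (one weight negated), it gives them semi-axis
   products M / X, M / Y, M / Z.  Applied to E' (semi-axis product m) and the
   contact triangle, in which O also has weights a, b, c, it gives
   o^2 X Y Z = 4 m^2.  Eliminating o yields 1/X + 1/Y + 1/Z = 1 + 2 M / m, which
   depends on the two ellipses only. *)

Require Import Defs.
From HB Require Import structures.
From mathcomp Require Import all_boot all_order all_algebra.
From mathcomp Require Import all_classical all_reals all_analysis.
From mathcomp Require Import ring lra measurable_realfun.

Set Implicit Arguments.
Unset Strict Implicit.
Unset Printing Implicit Defensive.

Import Order.TTheory GRing.Theory Num.Theory.
Import numFieldNormedType.Exports.

Local Open Scope classical_set_scope.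
Local Open Scope ring_scope.

(** * Area of an ellipse by slicing *)

Lemma sqrtr_1Bsqr_continuous (R : realType) :
  continuous (fun x : R => 2 * Num.sqrt (1 - x ^+ 2)).
Proof.
move=> x; apply: cvgM; first exact: cvg_cst.
apply: (@continuous_comp _ _ _ (fun x : R => 1 - x ^+ 2) Num.sqrt);
  last exact: sqrt_continuous.
apply: cvgB; first exact: cvg_cst.
exact: exprn_continuous.
Qed.

(* [Num.sqrt] vanishes on negative numbers, so the integrand is supported in
   [-1, 1].  Only the finiteness of this area is needed, not its value. *)
Definition disc_area (R : realType) : \bar R :=
  (\int[@lebesgue_measure R]_x (2 * Num.sqrt (1 - x ^+ 2))%:E)%E.

Lemma disc_area_fin (R : realType) : disc_area R \is a fin_num.
Proof.
have -> : disc_area R =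
    (\int[@lebesgue_measure R]_(x in `[(-1)%R, 1%R])
      (2 * Num.sqrt (1 - x ^+ 2))%:E)%E.
  rewrite [RHS]integral_mkcond; apply: eq_integral => x _; rewrite patchE.
  case: ifPn => // /negP xN; rewrite ler0_sqrtr ?mulr0// subr_le0.
  have [x1|x1] := leP 1 `|x|; first by rewrite -real_normK ?num_real// exprn_ege1.
  by exfalso; apply: xN; rewrite inE/= in_itv/= -ler_norml ltW.
apply: integrable_fin_num => //.
apply: (@continuous_compact_integrable R (fun x => 2 * Num.sqrt (1 - x ^+ 2))).
  exact: segment_compact.
apply: continuous_subspaceT; exact: sqrtr_1Bsqr_continuous.
Qed.

Lemma derive1_affine (R : realType) (k c : R) :
  derive1 (fun x : R => k * (x - c)) = cst k.
Proof.
apply/funext => x; rewrite derive1E.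
have h : is_derive x 1 (fun x : R => k * (x - c)) k.
  by apply: is_derive_eq; rewrite subr0; exact: mulr1.
exact: derive_val.
Qed.

Lemma measurable_disc_scaled (R : realType) (k c : R) :
  measurable_fun [set: measurableTypeR R]
    (fun x : R => 2 * Num.sqrt (1 - (k * (x - c)) ^+ 2)).
Proof.
apply: continuous_measurable_fun => x.
apply: (@continuous_comp _ _ _ (fun x : R => k * (x - c))
  (fun x => 2 * Num.sqrt (1 - x ^+ 2))); last exact: sqrtr_1Bsqr_continuous.
apply: cvgM; first exact: cvg_cst.
by apply: cvgB; [exact: cvg_id | exact: cvg_cst].
Qed.

Lemma integral_disc_scaled (R : realType) (k c : R) : 0 < k ->
  (\int[@lebesgue_measure R]_x (2 * Num.sqrt (1 - (k * (x - c)) ^+ 2))%:E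
   = (k^-1)%:E * disc_area R)%E.
Proof.
move=> k0.
rewrite [disc_area R](@increasing_ge0_integration_by_substitutionT R
  (fun x => k * (x - c)) (fun x => 2 * Num.sqrt (1 - x ^+ 2))); first last.
- by move=> x; rewrite mulr_ge0// sqrtr_ge0.
- exact: sqrtr_1Bsqr_continuous.
- apply: gt0_cvgMry => //; exact: cvg_addrr.
- apply: gt0_cvgMrNy => //; exact: cvg_addrr_Ny.
- by move=> x.
- by rewrite derive1_affine; apply: is_cvg_cst.
- by rewrite derive1_affine; apply: is_cvg_cst.
- by rewrite derive1_affine => x; apply: cst_continuous.
- by move=> x y xy; rewrite ltr_pM2l// ltrD2r.
rewrite derive1_affine -ge0_integralZl//=.
- apply: eq_integral => x _; rewrite -EFinM; congr EFin.
  rewrite -[RHS]/(k^-1 * (2 * Num.sqrt (1 - (k * (x - c)) ^+ 2) * k)).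
  by rewrite [RHS]mulrC mulfK ?gt_eqF.
- apply/measurable_EFinP; apply: measurable_funM; last exact: measurable_cst.
  exact: measurable_disc_scaled.
- by move=> x _; rewrite lee_fin !mulr_ge0 ?sqrtr_ge0// ltW.
- by rewrite lee_fin invr_ge0 ltW.
Qed.

(** Completing the square in [y] makes each nonempty vertical section an interval of half-length
    [Num.sqrt (1 - (k * (x - cx)) ^+ 2) / s]; integrating over [x] brings in the factor [1 / (s k)],
    which is [s1 s2]. *)
Lemma area_ellipse (R : realType) (E : ellipse R) :
  area E = ((semi1 E * semi2 E)%:E * disc_area R)%E.
Proof.
rewrite /area /product_measure1.
case: E => -[cx cy] [e1 e2] s1 s2 /= he s1p s2p.
pose C := (e2 / s1) ^+ 2 + (e1 / s2) ^+ 2.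
pose B := e1 * e2 * (s1^-1 ^+ 2 - s2^-1 ^+ 2).
have C0 : 0 < C.
  rewrite lt_def addr_ge0 ?sqr_ge0// andbT paddr_eq0 ?sqr_ge0//.
  rewrite !sqrf_eq0 !mulf_eq0 !invr_eq0 (gt_eqF s1p) (gt_eqF s2p) !orbF.
  apply/negP => /andP[/eqP e20 /eqP e10].
  by move: he; rewrite e20 e10 expr0n addr0 => /eqP; rewrite eq_sym oner_eq0.
pose s := Num.sqrt C.
have s0 : 0 < s by rewrite sqrtr_gt0.
have sC : s ^+ 2 = C by rewrite sqr_sqrtr// ltW.
pose k := (s1 * s2 * s)^-1.
have k0 : 0 < k by rewrite invr_gt0 !mulr_gt0.
have formE x y : ((e1 * (x - cx) + e2 * (y - cy)) / s1) ^+ 2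
    + ((e1 * (y - cy) - e2 * (x - cx)) / s2) ^+ 2 =
    (s * (y - (cy - B / C * (x - cx)))) ^+ 2 + (k * (x - cx)) ^+ 2.
  pose A := (e1 / s1) ^+ 2 + (e2 / s2) ^+ 2.
  (* The determinant [A C - B ^+ 2] of the form is [(s1 s2) ^- 2]; the squared norm of the unit axis
     is inserted to make this a rational identity. *)
  have hD : A = (B ^+ 2 + (s1 * s2) ^- 2) / C.
    apply/(canRL (mulfK _)); first by rewrite gt_eqF.
    have -> : (s1 * s2) ^- 2 = (e1 ^+ 2 + e2 ^+ 2) ^+ 2 / (s1 * s2) ^+ 2.
      by rewrite he expr1n mul1r.
    by rewrite /A /B /C; field; rewrite !gt_eqF.
  transitivity (A * (x - cx) ^+ 2 + 2 * B * (x - cx) * (y - cy) + C * (y - cy) ^+ 2).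
    by rewrite /A /B /C; field; rewrite !gt_eqF.
  rewrite [(s * _) ^+ 2]exprMn [(k * _) ^+ 2]exprMn exprVn exprMn sC hD.
  by field; rewrite !gt_eqF.
transitivity (\int[@lebesgue_measure R]_x
    ((s^-1)%:E * (2 * Num.sqrt (1 - (k * (x - cx)) ^+ 2))%:E))%E.
  apply: eq_integral => x _ /=.
  set w := Num.sqrt _.
  pose y0 := cy - B / C * (x - cx).
  (* Where the radicand is negative the section is empty and [Num.sqrt] takes its default value 0,
     so both sides vanish. *)
  have [neg|pos] := ltP (1 - (k * (x - cx)) ^+ 2) 0.
    rewrite /w ler0_sqrtr ?ltW// mulr0 mule0.
    rewrite (_ : xsection _ _ = set0) ?measure0// -subset0 => y.
    rewrite /xsection /= inE /region/= /ellipse_form /= formE => h.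
    have := sqr_ge0 (s * (y - (cy - B / C * (x - cx)))); lra.
  have w0 : 0 <= w by exact: sqrtr_ge0.
  have wE : 1 - (k * (x - cx)) ^+ 2 = w ^+ 2 by rewrite sqr_sqrtr.
  rewrite (_ : xsection _ _ = `[y0 - w / s, y0 + w / s]%classic); last first.
    apply/predeqP => y; rewrite /xsection /= inE /region /= /ellipse_form /= formE.
    rewrite in_itv /= -lerBrDr wE -ler_distl ler_pdivlMr// mulrC.
    rewrite -{2}(gtr0_norm s0) -normrM -[`|_| <= w](ler_pXn2r (ltn0Sn 1)) ?nnegrE//.
    by rewrite real_normK ?num_real.
  rewrite lebesgue_measure_itv /= lte_fin -EFinB.
  have -> : ((s^-1)%:E * (2 * w)%:E)%E = (y0 + w / s - (y0 - w / s))%:E :> \bar R.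
    by rewrite -EFinM; congr EFin; ring.
  have ws0 : 0 <= w / s by rewrite divr_ge0// ltW.
  by case: ltP => // h; congr EFin; lra.
rewrite ge0_integralZl//=.
- by rewrite integral_disc_scaled// muleA -EFinM; congr (_%:E * _)%E;
    rewrite /k; field; rewrite !gt_eqF.
- by apply/measurable_EFinP; exact: measurable_disc_scaled.
- by rewrite lee_fin invr_ge0 ltW.
Qed.

(** * The scalar product attached to an ellipse *)

Section Polar.
Variables (R : realType) (E : ellipse R).
Implicit Types u v w p q : R * R.

Definition cross u v : R := u.1 * v.2 - u.2 * v.1.

(** The scalar product whose unit circle is [E] translated to the origin. *)
Definition polar u v : R :=
  ((eaxis E).1 * u.1 + (eaxis E).2 * u.2) / semi1 E
    * (((eaxis E).1 * v.1 + (eaxis E).2 * v.2) / semi1 E)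
  + ((eaxis E).1 * u.2 - (eaxis E).2 * u.1) / semi2 E
    * (((eaxis E).1 * v.2 - (eaxis E).2 * v.1) / semi2 E).

Lemma ellipse_formE X :
  ellipse_form E X = polar (X - ecenter E) (X - ecenter E).
Proof. by rewrite /ellipse_form /polar -!expr2. Qed.

Lemma polarC u v : polar u v = polar v u.
Proof. by rewrite /polar; ring. Qed.

Lemma polar_lincomb p u v w a b :
  w.1 = a * u.1 + b * v.1 -> w.2 = a * u.2 + b * v.2 ->
  polar p w = a * polar p u + b * polar p v.
Proof. by rewrite /polar => -> ->; ring. Qed.

Lemma polar_lincomb3 p u v w a b c :
  a * u.1 + b * v.1 + c * w.1 = 0 -> a * u.2 + b * v.2 + c * w.2 = 0 ->
  a * polar p u + b * polar p v + c * polar p w = 0.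
Proof.
move=> h1 h2.
have -> : a * polar p u + b * polar p v + c * polar p w =
    polar p (a * u.1 + b * v.1 + c * w.1, a * u.2 + b * v.2 + c * w.2).
  by rewrite /polar /=; ring.
by rewrite h1 h2 /polar /=; ring.
Qed.

(** Binet-Cauchy: [polar] is the Euclidean scalar product pulled back along a linear map of
    determinant [1 / (semi1 E * semi2 E)]. *)
Lemma polar_det u w p q :
  (polar u p * polar w q - polar u q * polar w p) * (semi1 E * semi2 E) ^+ 2 =
  cross u w * cross p q.
Proof.
have s1 := semi1_gt0 E; have s2 := semi2_gt0 E.
transitivity (((eaxis E).1 ^+ 2 + (eaxis E).2 ^+ 2) ^+ 2 * (cross u w * cross p q)).
  by rewrite /polar /cross; field; rewrite !gt_eqF.
by rewrite eaxis_unit expr1n mul1r.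
Qed.

Lemma polar_gram u v :
  (polar u u * polar v v - polar u v ^+ 2) * (semi1 E * semi2 E) ^+ 2 =
  cross u v ^+ 2.
Proof. by rewrite [RHS]expr2 -polar_det (polarC v u) expr2. Qed.

Lemma semi_prod_gt0 : 0 < semi1 E * semi2 E.
Proof. by rewrite mulr_gt0 ?semi1_gt0 ?semi2_gt0. Qed.

(** Cauchy-Schwarz, read off the nonnegative Gram determinant. *)
Lemma polar_le1 u v : polar u u = 1 -> polar v v = 1 -> polar u v <= 1.
Proof.
move=> hu hv.
have : 0 <= 1 - polar u v ^+ 2.
  rewrite -(pmulr_lge0 _ (exprn_gt0 2 semi_prod_gt0)).
  by have := polar_gram u v; rewrite hu hv mulr1 => ->; rewrite sqr_ge0.
by nra.
Qed.

Lemma polar_gt0 u : u != (0, 0) -> 0 < polar u u.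
Proof.
move=> u0; rewrite lt_def /polar -!expr2 addr_ge0 ?sqr_ge0// andbT.
rewrite paddr_eq0 ?sqr_ge0// !sqrf_eq0 !mulf_eq0 !invr_eq0.
rewrite !(gt_eqF (semi1_gt0 E)) !(gt_eqF (semi2_gt0 E)) !orbF.
apply: contra u0 => /andP[/eqP h1 /eqP h2]; case: u h1 h2 => a b /= h1 h2.
have := eaxis_unit E.
move: (eaxis E).1 (eaxis E).2 h1 h2 => e f h1 h2 he.
(* The inverse rotation recovers [u] from its components along the two axes, both of which
   vanish. *)
have -> : a = a * (e ^+ 2 + f ^+ 2) by rewrite he mulr1.
have -> : b = b * (e ^+ 2 + f ^+ 2) by rewrite he mulr1.
have -> : a * (e ^+ 2 + f ^+ 2) = e * (e * a + f * b) - f * (e * b - f * a) by ring.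
have -> : b * (e ^+ 2 + f ^+ 2) = f * (e * a + f * b) + e * (e * b - f * a) by ring.
by rewrite h1 h2 !mulr0 subr0 addr0.
Qed.

(* Heron's formula in disguise: [x p1], [y p2], [z p3] are the sides of a
   triangle, of lengths x, y, z for the norm of [E]. *)
Lemma polar_heron p1 p2 p3 x y z :
  polar p1 p1 = 1 -> polar p2 p2 = 1 -> polar p3 p3 = 1 ->
  x * p1.1 + y * p2.1 + z * p3.1 = 0 -> x * p1.2 + y * p2.2 + z * p3.2 = 0 ->
  (semi1 E * semi2 E) ^+ 2
    * ((x + y + z) * (y + z - x) * (z + x - y) * (x + y - z)) =
  4 * x ^+ 2 * y ^+ 2 * cross p1 p2 ^+ 2.
Proof.
move=> h1 h2 h3 e1 e2.
have k1 := polar_lincomb3 p1 e1 e2.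
have k2 := polar_lincomb3 p2 e1 e2.
have k3 := polar_lincomb3 p3 e1 e2.
rewrite -polar_gram h1 h2.
rewrite (polarC p2 p1) in k2; rewrite (polarC p3 p1) (polarC p3 p2) in k3.
rewrite h1 h2 h3 in k1 k2 k3.
move: (polar p1 p2) (polar p1 p3) (polar p2 p3) k1 k2 k3 => c b a k1 k2 k3.
(* Law of cosines in that triangle: [x] times [k1] plus [y] times [k2] minus [z] times [k3]. *)
have hc : 2 * x * y * c = z ^+ 2 - x ^+ 2 - y ^+ 2.
  apply/eqP; rewrite -subr_eq0; apply/eqP.
  transitivity (x * (x * 1 + y * c + z * b) + y * (x * c + y * 1 + z * a)
    - z * (x * b + y * a + z * 1)); first by ring.
  by rewrite k1 k2 k3; ring.
have -> : 4 * x ^+ 2 * y ^+ 2 * ((1 * 1 - c ^+ 2) * (semi1 E * semi2 E) ^+ 2) =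
  (semi1 E * semi2 E) ^+ 2 * (4 * x ^+ 2 * y ^+ 2 - (2 * x * y * c) ^+ 2).
  by ring.
by rewrite hc; ring.
Qed.

End Polar.

(** * Barycentric weights, circumellipses and tangent chords *)

Section Incidence.
Variable R : realType.
Implicit Types P A B Q X O : R * R.

(* The weights are the barycentric coordinates of [Q], up to a common factor. *)
Definition weights P1 P2 P3 Q (x y z : R) : Prop :=
  x * (P1 - Q).1 + y * (P2 - Q).1 + z * (P3 - Q).1 = 0 /\
  x * (P1 - Q).2 + y * (P2 - Q).2 + z * (P3 - Q).2 = 0.

(** Barycentric weights as area ratios: take the cross product of the weight relation with
    [P2 - P1]. *)
Lemma weights_cross P1 P2 P3 Q x y z : weights P1 P2 P3 Q x y z ->
  (x + y + z) * cross (P1 - Q) (P2 - Q) = z * orient P1 P2 P3.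
Proof.
case=> h1 h2.
have -> : orient P1 P2 P3 = cross (P1 - Q) (P2 - Q) + cross (P2 - Q) (P3 - Q)
    + cross (P3 - Q) (P1 - Q).
  by rewrite /orient /cross /=; ring.
move: (P1 - Q) (P2 - Q) (P3 - Q) h1 h2 => p1 p2 p3 h1 h2.
apply/eqP; rewrite -subr_eq0; apply/eqP; rewrite /cross.
transitivity ((x * p1.1 + y * p2.1 + z * p3.1) * (p2.2 - p1.2)
  - (x * p1.2 + y * p2.2 + z * p3.2) * (p2.1 - p1.1)); first by ring.
by rewrite h1 h2 !mul0r subr0.
Qed.

Lemma weights_orient P1 P2 P3 Q :
  weights P1 P2 P3 Q (orient P2 P3 Q) (orient P3 P1 Q) (orient P1 P2 Q).
Proof. by split; rewrite /orient /=; ring. Qed.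

Lemma orient_sum P1 P2 P3 Q :
  orient P2 P3 Q + orient P3 P1 Q + orient P1 P2 Q = orient P1 P2 P3.
Proof. by rewrite /orient; ring. Qed.

Lemma weightsZ P1 P2 P3 Q k x y z : weights P1 P2 P3 Q x y z ->
  weights P1 P2 P3 Q (k * x) (k * y) (k * z).
Proof. by case=> h1 h2; split; rewrite -!mulrA -!mulrDr ?h1 ?h2 mulr0. Qed.

(** [polar_heron] for the vertices seen from the centre, times [(x + y + z) ^+ 2], so that
    [weights_cross] replaces a cross product depending on [Q] by the area of the triangle. Negative
    weights are covered, as the anticevian points require. *)
Lemma circumellipse_semi (C : ellipse R) P1 P2 P3 Q x y z :
  weights P1 P2 P3 Q x y z -> is_circumellipse P1 P2 P3 Q C ->
  (semi1 C * semi2 C) ^+ 2 * (x + y + z) ^+ 3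
    * ((y + z - x) * (z + x - y) * (x + y - z)) =
  4 * x ^+ 2 * y ^+ 2 * z ^+ 2 * orient P1 P2 P3 ^+ 2.
Proof.
move=> w [hQ]; rewrite /curve /= !ellipse_formE hQ => h1 h2 h3.
have wc := weights_cross w.
case: w => w1 w2; have := polar_heron h1 h2 h3 w1 w2 => heron.
transitivity ((semi1 C * semi2 C) ^+ 2
    * ((x + y + z) * (y + z - x) * (z + x - y) * (x + y - z)) * (x + y + z) ^+ 2).
  by ring.
rewrite heron.
transitivity (4 * x ^+ 2 * y ^+ 2
  * ((x + y + z) * cross (P1 - Q) (P2 - Q)) ^+ 2); first by ring.
by rewrite wc; ring.
Qed.

(** The vector [t] goes from [O] to the contact point. It falls strictly between [A] and [B] because
    it is inside [E], and the side is the polar line of [t] with respect to [E']. *)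
Lemma tangent_contact (E E' : ellipse R) O A B :
  ecenter E = O -> ecenter E' = O -> curve E' `<=` inside E ->
  A <> B -> curve E A -> curve E B -> tangent_to (line A B) E' ->
  exists (t : R * R) (s : R),
    [/\ 0 < s, s < 1,
        t.1 = (1 - s) * (A - O).1 + s * (B - O).1,
        t.2 = (1 - s) * (A - O).2 + s * (B - O).2
      & [/\ polar E' t t = 1, polar E' t (A - O) = 1
          & polar E' t (B - O) = 1]].
Proof.
move=> hE hE' hin AB; rewrite /curve /= !ellipse_formE hE => hA hB.
case=> T [[lT cT] uT].
pose d := B - A.
have d0 : d != (0, 0).
  apply/eqP => -[] /eqP; rewrite subr_eq0 => /eqP h1 /eqP.
  rewrite subr_eq0 => /eqP h2; apply: AB.
  by case: A B h1 h2 {hA hB lT uT d} => ? ? [? ?] /= -> ->.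
have N0 : 0 < d.1 ^+ 2 + d.2 ^+ 2.
  rewrite lt_def addr_ge0 ?sqr_ge0// andbT paddr_eq0 ?sqr_ge0// !sqrf_eq0.
  by apply: contra d0; case: d => ? ? /= /andP[/eqP-> /eqP->].
(* Parameter of the orthogonal projection onto the line; as [T] is on the line, [T = A + s d]. *)
pose s := ((T.1 - A.1) * d.1 + (T.2 - A.2) * d.2) / (d.1 ^+ 2 + d.2 ^+ 2).
have lT0 : d.1 * (T.2 - A.2) - d.2 * (T.1 - A.1) = 0 by [].
have T1 : T.1 - A.1 = s * d.1.
  apply: (mulfI (lt0r_neq0 N0)); rewrite /s mulrA mulrCA divff ?gt_eqF// mulr1.
  apply/eqP; rewrite -subr_eq0; apply/eqP.
  transitivity (- d.2 * (d.1 * (T.2 - A.2) - d.2 * (T.1 - A.1))); first by ring.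
  by rewrite lT0 mulr0.
have T2 : T.2 - A.2 = s * d.2.
  apply: (mulfI (lt0r_neq0 N0)); rewrite /s mulrA mulrCA divff ?gt_eqF// mulr1.
  apply/eqP; rewrite -subr_eq0; apply/eqP.
  transitivity (d.1 * (d.1 * (T.2 - A.2) - d.2 * (T.1 - A.1))); first by ring.
  by rewrite lT0 mulr0.
have t1 : (T - O).1 = (1 - s) * (A - O).1 + s * (B - O).1.
  rewrite /=; transitivity (A.1 + (T.1 - A.1) - O.1); first by ring.
  by rewrite T1 /=; ring.
have t2 : (T - O).2 = (1 - s) * (A - O).2 + s * (B - O).2.
  rewrite /=; transitivity (A.2 + (T.2 - A.2) - O.2); first by ring.
  by rewrite T2 /=; ring.
have tin : polar E (T - O) (T - O) < 1 by rewrite -{1 2}hE -ellipse_formE; exact: hin.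
move: cT; rewrite /curve /= ellipse_formE hE' => cT.
(* On the chord the form of [E] equals [1 - 2 s (1 - s) (1 - p)], where [p <= 1] is the scalar
   product of [A - O] and [B - O]. *)
have s01 : 0 < s * (1 - s).
  move: tin; rewrite (polar_lincomb E (T - O) t1 t2) !(polarC E (T - O)).
  rewrite !(polar_lincomb E _ t1 t2) hA hB (polarC E (B - O)).
  by have := polar_le1 hA hB; nra.
have b0 : polar E' (T - O) d = 0.
  pose g := polar E' d d; have g0 : 0 < g := polar_gt0 E' d0.
  pose b := polar E' (T - O) d.
  (* [X] is the reflection of [T] along [d] for the scalar product of [E'], hence again a common
     point of line and curve; uniqueness forces [k = 0]. *)
  pose k := 2 * b / g.
  pose X := (T.1 - k * d.1, T.2 - k * d.2) : R * R.
  have /uT XT : line A B X /\ curve E' X.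
    split.
      rewrite /line /= /orient /=.
      transitivity (d.1 * (T.2 - A.2) - d.2 * (T.1 - A.1)); last by [].
      by rewrite /d /=; ring.
    rewrite /curve /= ellipse_formE hE'.
    have x1 : (X - O).1 = 1 * (T - O).1 + (- (k)) * d.1 by rewrite /=; ring.
    have x2 : (X - O).2 = 1 * (T - O).2 + (- (k)) * d.2 by rewrite /=; ring.
    rewrite (polar_lincomb E' (X - O) x1 x2) !(polarC E' (X - O)).
    rewrite !(polar_lincomb E' _ x1 x2) cT (polarC E' d) -/b -/g.
    by rewrite /k; field; rewrite gt_eqF.
  have e1 : k * d.1 = 0.
    transitivity (T.1 - (T.1 - k * d.1)); first by ring.
    by rewrite -[T.1 - k * _](congr1 fst XT) subrr.
  have e2 : k * d.2 = 0.
    transitivity (T.2 - (T.2 - k * d.2)); first by ring.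
    by rewrite -[T.2 - k * _](congr1 snd XT) subrr.
  apply/eqP; apply: contraT => bn0.
  have k0 : k != 0.
    by apply: mulf_neq0; [apply: mulf_neq0|rewrite invr_eq0 gt_eqF].

  move/eqP: e1; rewrite mulf_eq0 (negPf k0) /= => /eqP e1.
  move/eqP: e2; rewrite mulf_eq0 (negPf k0) /= => /eqP e2.
  by case/eqP: d0; apply: injective_projections.
have pAB : polar E' (T - O) (B - O) = polar E' (T - O) (A - O).
  apply/eqP; rewrite -subr_eq0; apply/eqP; rewrite -[RHS]b0 /polar /d /=; ring.
have pA : polar E' (T - O) (A - O) = 1.
  by move: cT; rewrite {2}/(T - O) (polar_lincomb E' _ t1 t2) pAB => <-; ring.
exists (T - O), s; split=> //; first by nra.
- by nra.
- by split=> //; rewrite pAB.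
Qed.

End Incidence.

(** * Constructing ellipses from quadratic forms *)

Section Existence.
Variable R : realType.
Implicit Types P Q : R * R.

Lemma ellipse_of_form Q (A B C : R) : 0 < A -> 0 < A * C - B ^+ 2 ->
  exists2 E : ellipse R, ecenter E = Q & forall X : R * R,
    ellipse_form E X = A * (X.1 - Q.1) ^+ 2
      + 2 * B * (X.1 - Q.1) * (X.2 - Q.2) + C * (X.2 - Q.2) ^+ 2.
Proof.
move=> A0 D0; have C0 : 0 < C by nra.
have invsqr (a : R) : 0 < a -> 0 < (Num.sqrt a)^-1 by move=> ?; rewrite invr_gt0 sqrtr_gt0.
have scale (x a : R) : 0 < a -> (x / (Num.sqrt a)^-1) ^+ 2 = a * x ^+ 2.
  by move=> a0; rewrite invrK exprMn sqr_sqrtr ?ltW// mulrC.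
(* The eigenvector [(B, k)] used below can vanish when [B = 0]; the axes are then the coordinate
   axes. *)
have [B0|B0] := eqVneq B 0.
  have u : (1 : R, 0 : R).1 ^+ 2 + (1 : R, 0 : R).2 ^+ 2 = 1.
    by rewrite /= expr1n expr0n addr0.
  exists (@Ellipse R Q (1, 0) _ _ u (invsqr A A0) (invsqr C C0)) => // X.
  by rewrite /ellipse_form /= !scale// B0; ring.
pose r := Num.sqrt ((A - C) ^+ 2 + 4 * B ^+ 2).
have r2 : r ^+ 2 = (A - C) ^+ 2 + 4 * B ^+ 2.
  by rewrite sqr_sqrtr// addr_ge0 ?sqr_ge0// mulr_ge0 ?sqr_ge0.
have r0 : 0 <= r by rewrite sqrtr_ge0.
(* [l] and [m] are the eigenvalues of the symmetric matrix with entries [A], [B], [C]; since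
   [k = l - A], the vector [(B, k)] is an eigenvector for [l]. The semi-axes are the inverse square
   roots of the eigenvalues. *)
pose l := (A + C + r) / 2; pose m := (A + C - r) / 2; pose k := (C - A + r) / 2.
have l0 : 0 < l by rewrite /l; lra.
have lm : l * m = A * C - B ^+ 2.
  by transitivity (((A + C) ^+ 2 - r ^+ 2) / 4); [rewrite /l /m; field|rewrite r2; field].
have m0 : 0 < m by rewrite -(pmulr_rgt0 _ l0) lm.
have kB : k ^+ 2 = k * (C - A) + B ^+ 2.
  have -> : k ^+ 2 = k * (C - A) + (r ^+ 2 - (A - C) ^+ 2) / 4 by rewrite /k; field.
  by rewrite r2; field.
have lk : l = A + k by rewrite /l /k; field.
have mk : m = C - k by rewrite /m /k; field.
pose n2 := B ^+ 2 + k ^+ 2.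
have n20 : 0 < n2 by rewrite ltr_pwDl ?sqr_ge0// exprn_even_gt0.
have nn : Num.sqrt n2 ^+ 2 = n2 by rewrite sqr_sqrtr ?ltW.
have sn0 : Num.sqrt n2 != 0 by rewrite gt_eqF ?sqrtr_gt0.
pose e : R * R := (B / Num.sqrt n2, k / Num.sqrt n2).
have u : e.1 ^+ 2 + e.2 ^+ 2 = 1.
  transitivity ((B ^+ 2 + k ^+ 2) / Num.sqrt n2 ^+ 2); first by rewrite /e /=; field.
  by rewrite nn divff ?gt_eqF.
exists (@Ellipse R Q e _ _ u (invsqr l l0) (invsqr m m0)) => // X.
rewrite /ellipse_form /= !scale//.
move: (X.1 - Q.1) (X.2 - Q.2) => x y.
transitivity ((l * (B * x + k * y) ^+ 2 + m * (B * y - k * x) ^+ 2) / Num.sqrt n2 ^+ 2).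
  by field.
rewrite nn; apply/(canLR (mulfK (lt0r_neq0 n20))).
rewrite /n2 lk mk.
apply/eqP; rewrite -subr_eq0; apply/eqP.
transitivity ((k ^+ 2 - (k * (C - A) + B ^+ 2))
  * (k * y ^+ 2 + 2 * B * x * y - k * x ^+ 2)); first by ring.
by rewrite kB subrr mul0r.
Qed.

Lemma circumellipse_exists P1 P2 P3 Q x y z :
  weights P1 P2 P3 Q x y z -> x != 0 -> y != 0 -> z != 0 ->
  0 < (x + y + z) * (y + z - x) * (z + x - y) * (x + y - z) ->
  orient P1 P2 P3 != 0 ->
  exists C : ellipse R, is_circumellipse P1 P2 P3 Q C.
Proof.
move=> w x0 y0 z0 pos o0.
have wc := weights_cross w.
case: w => w1 w2.
pose p1 := P1 - Q; pose p2 := P2 - Q; pose p3 := P3 - Q.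
pose k := cross p1 p2.
have k0 : k != 0.
  by apply/eqP => k0; move/eqP: wc; rewrite -/p1 -/p2 -/k k0 mulr0 eq_sym mulf_eq0 (negPf z0) (negPf o0).
(* The scalar product of [p1] and [p2] forced by the law of cosines; the sign of the Heron product
   says exactly that its square is below 1. *)
pose c := (z ^+ 2 - x ^+ 2 - y ^+ 2) / (2 * x * y).
have c1 : 0 < 1 - c ^+ 2.
  have xy0 : 0 < (2 * x * y) ^+ 2 by rewrite exprn_even_gt0//= !mulf_neq0 ?pnatr_eq0.
  rewrite -(pmulr_lgt0 _ xy0); move: pos; congr (0 < _).
  by rewrite /c; field; rewrite x0 y0.
(* The form [f ^+ 2 + 2 c f g + g ^+ 2], where [f] and [g] are the coordinates of [X - Q] in the
   basis [p1], [p2]. *)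
have [|| C hC fC] := @ellipse_of_form Q
  ((p2.2 ^+ 2 - 2 * c * p2.2 * p1.2 + p1.2 ^+ 2) / k ^+ 2)
  ((c * (p2.2 * p1.1 + p2.1 * p1.2) - p2.2 * p2.1 - p1.1 * p1.2) / k ^+ 2)
  ((p2.1 ^+ 2 - 2 * c * p2.1 * p1.1 + p1.1 ^+ 2) / k ^+ 2).
- rewrite divr_gt0 ?exprn_even_gt0//.
  have -> : p2.2 ^+ 2 - 2 * c * p2.2 * p1.2 + p1.2 ^+ 2 =
      (p2.2 - c * p1.2) ^+ 2 + (1 - c ^+ 2) * p1.2 ^+ 2 by ring.
  have [p10|p10] := eqVneq p1.2 0; last first.
    by rewrite ltr_wpDl ?sqr_ge0// mulr_gt0 ?exprn_even_gt0.
  rewrite p10 expr0n !mulr0 subr0 addr0 exprn_even_gt0//.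
  by apply: contra k0 => /eqP p20; rewrite /k /cross p10 p20 mulr0 mul0r subr0.
- rewrite (_ : _ - _ = (1 - c ^+ 2) / k ^+ 2) ?divr_gt0 ?exprn_even_gt0//.
  apply: (mulfI (_ : k ^+ 4 != 0)); first by rewrite expf_neq0.
  transitivity ((1 - c ^+ 2) * cross p1 p2 ^+ 2); last by rewrite -/k; field.
  by rewrite /cross; field.
have fC' X : ellipse_form C X = (cross (X - Q) p2 ^+ 2
    + 2 * c * cross (X - Q) p2 * cross p1 (X - Q) + cross p1 (X - Q) ^+ 2) / k ^+ 2.
  by rewrite fC /cross /=; field.
have z1 : z * cross p3 p2 = - x * k.
  apply/eqP; rewrite -subr_eq0; apply/eqP.
  transitivity ((x * p1.1 + y * p2.1 + z * p3.1) * p2.2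
    - (x * p1.2 + y * p2.2 + z * p3.2) * p2.1); first by rewrite /k /cross; ring.
  by rewrite w1 w2 !mul0r subr0.
have z2 : z * cross p1 p3 = - y * k.
  apply/eqP; rewrite -subr_eq0; apply/eqP.
  transitivity ((x * p1.2 + y * p2.2 + z * p3.2) * p1.1
    - (x * p1.1 + y * p2.1 + z * p3.1) * p1.2); first by rewrite /k /cross; ring.
  by rewrite w1 w2 !mul0r subr0.
have crossvv (v : R * R) : cross v v = 0 by rewrite /cross; ring.
exists C; split=> //; rewrite /curve /= fC'.
- by rewrite -/p1 -/k crossvv; field.
- by rewrite -/p2 -/k crossvv; field.
- rewrite -/p3 (canRL (mulKf z0) z1) (canRL (mulKf z0) z2) /c.
  by field; rewrite x0 y0 z0 k0.
Qed.

End Existence.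

(** * From trilinears to barycentric weights *)

Section Trilinears.
Variable R : realType.
Implicit Types A B C X P Q O : R * R.

Lemma orient_rot A B C : orient B C A = orient A B C.
Proof. by rewrite /orient; ring. Qed.

(** The factor depends on the triangle only, so it cancels when the trilinears of two points are
    compared. *)
Lemma sdistE A B C : orient A B C != 0 ->
  exists2 r : R, r != 0 & forall X, sdist A B C X = r * orient B C X.
Proof.
move=> o0; exists (Num.sg (orient B C A) / eucl_dist B C); last first.
  by move=> X; rewrite /sdist mulrAC.
apply: mulf_neq0; first by rewrite sgr_eq0 orient_rot.
apply: invr_neq0; apply: lt0r_neq0; rewrite sqrtr_gt0.
rewrite lt_def addr_ge0 ?sqr_ge0 // andbT paddr_eq0 ?sqr_ge0 // !sqrf_eq0.
apply: contra o0 => /andP[/eqP h1 /eqP h2].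
by rewrite -orient_rot /orient h1 h2 !mul0r subr0.
Qed.

Lemma trilinears_orient P1 P2 P3 O Q u v w e1 e2 e3 : orient P1 P2 P3 != 0 ->
  has_trilinears P1 P2 P3 O u v w ->
  has_trilinears P1 P2 P3 Q (e1 * u) (e2 * v) (e3 * w) ->
  exists2 k, k != 0 &
    [/\ orient P2 P3 Q = k * (e1 * orient P2 P3 O),
        orient P3 P1 Q = k * (e2 * orient P3 P1 O)
      & orient P1 P2 Q = k * (e3 * orient P1 P2 O)].
Proof.
move=> o0.
have [|r1 r10 s1] := @sdistE P1 P2 P3; first by [].
have [|r2 r20 s2] := @sdistE P2 P3 P1; first by rewrite orient_rot.
have [|r3 r30 s3] := @sdistE P3 P1 P2; first by rewrite -orient_rot.
case=> k k0 [h1 h2 h3] [k' k0' [h1' h2' h3']].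
exists (k' / k); first by rewrite mulf_neq0 ?invr_eq0.
rewrite s1 in h1; rewrite s2 in h2; rewrite s3 in h3.
rewrite s1 in h1'; rewrite s2 in h2'; rewrite s3 in h3'.
have E (r a b e t : R) : r != 0 -> r * a = k * t -> r * b = k' * (e * t) ->
    b = k' / k * (e * a).
  move=> r0 ha hb; apply: (mulfI r0); rewrite hb.
  transitivity (k' / k * (e * (r * a))); last by ring.
  by rewrite ha; field.
by split; [apply: E r10 h1 h1'|apply: E r20 h2 h2'|apply: E r30 h3 h3'].
Qed.

Lemma orient_trilinears P1 P2 P3 O Q k e1 e2 e3 : orient P1 P2 P3 != 0 -> k != 0 ->
  orient P2 P3 Q = k * (e1 * orient P2 P3 O) ->
  orient P3 P1 Q = k * (e2 * orient P3 P1 O) ->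
  orient P1 P2 Q = k * (e3 * orient P1 P2 O) ->
  has_trilinears P1 P2 P3 Q (e1 * sdist P1 P2 P3 O) (e2 * sdist P2 P3 P1 O)
    (e3 * sdist P3 P1 P2 O).
Proof.
move=> o0 k0 h1 h2 h3; exists k => //.
have [|r1 r10 s1] := @sdistE P1 P2 P3; first by [].
have [|r2 r20 s2] := @sdistE P2 P3 P1; first by rewrite orient_rot.
have [|r3 r30 s3] := @sdistE P3 P1 P2; first by rewrite -orient_rot.
by split; [rewrite !s1 h1|rewrite !s2 h2|rewrite !s3 h3]; ring.
Qed.

Lemma weights_trilinears P1 P2 P3 O Q u v w e1 e2 e3 a b c :
  orient P1 P2 P3 != 0 ->
  orient P2 P3 O = a * orient P1 P2 P3 -> orient P3 P1 O = b * orient P1 P2 P3 ->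
  orient P1 P2 O = c * orient P1 P2 P3 ->
  has_trilinears P1 P2 P3 O u v w ->
  has_trilinears P1 P2 P3 Q (e1 * u) (e2 * v) (e3 * w) ->
  weights P1 P2 P3 Q (e1 * a) (e2 * b) (e3 * c).
Proof.
move=> o0 ha hb hc tO tQ.
have [k k0 [h1 h2 h3]] := trilinears_orient o0 tO tQ.
have := weightsZ (k * orient P1 P2 P3)^-1 (weights_orient P1 P2 P3 Q).
rewrite h1 h2 h3 ha hb hc; move: (orient P1 P2 P3) o0 => o o0.
have E (e x : R) : (k * o)^-1 * (k * (e * (x * o))) = e * x by field; rewrite o0 k0.
by rewrite !E.
Qed.

Lemma point_of_weights P1 P2 P3 x y z : x + y + z != 0 ->
  exists Q, [/\ orient P2 P3 Q = (x + y + z)^-1 * (x * orient P1 P2 P3),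
                orient P3 P1 Q = (x + y + z)^-1 * (y * orient P1 P2 P3)
              & orient P1 P2 Q = (x + y + z)^-1 * (z * orient P1 P2 P3)].
Proof.
move=> s0.
exists ((x * P1.1 + y * P2.1 + z * P3.1) / (x + y + z),
        (x * P1.2 + y * P2.2 + z * P3.2) / (x + y + z)).
by rewrite /orient /=; split; field.
Qed.

Lemma anticevian_weights P1 P2 P3 O Q1 Q2 Q3 a b c :
  orient P1 P2 P3 != 0 ->
  orient P2 P3 O = a * orient P1 P2 P3 -> orient P3 P1 O = b * orient P1 P2 P3 ->
  orient P1 P2 O = c * orient P1 P2 P3 ->
  is_anticevian P1 P2 P3 O Q1 Q2 Q3 ->
  [/\ weights P1 P2 P3 Q1 (- a) b c, weights P1 P2 P3 Q2 a (- b) c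
    & weights P1 P2 P3 Q3 a b (- c)].
Proof.
move=> o0 ha hb hc [u [v [w [tO t1 t2 t3]]]].
rewrite -mulN1r -[v]mul1r -[w]mul1r in t1.
rewrite -mulN1r -[u]mul1r -[w]mul1r in t2.
rewrite -mulN1r -[u]mul1r -[v]mul1r in t3.
have := weights_trilinears o0 ha hb hc tO t1.
have := weights_trilinears o0 ha hb hc tO t2.
have := weights_trilinears o0 ha hb hc tO t3.
by rewrite !mulN1r !mul1r.
Qed.

(** The nonzero sums keep the three vertices away from infinity. *)
Lemma anticevian_exists P1 P2 P3 O a b c :
  orient P1 P2 P3 != 0 ->
  orient P2 P3 O = a * orient P1 P2 P3 -> orient P3 P1 O = b * orient P1 P2 P3 ->
  orient P1 P2 O = c * orient P1 P2 P3 ->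
  - a + b + c != 0 -> a - b + c != 0 -> a + b - c != 0 ->
  exists Q1 Q2 Q3, is_anticevian P1 P2 P3 O Q1 Q2 Q3.
Proof.
move=> o0 ha hb hc s1 s2 s3.
have [Q1 []] := point_of_weights P1 P2 P3 s1.
have [Q2 []] := point_of_weights P1 P2 P3 s2.
have [Q3 []] := point_of_weights P1 P2 P3 s3.
rewrite !mulNr -ha -hb -hc => h1 h2 h3 g1 g2 g3 f1 f2 f3.
exists Q1, Q2, Q3, (sdist P1 P2 P3 O), (sdist P2 P3 P1 O), (sdist P3 P1 P2 O).
have E k Q e1 e2 e3 := @orient_trilinears P1 P2 P3 O Q k e1 e2 e3 o0.
split; first by exists 1; rewrite ?oner_neq0// !mul1r.
- have := E _ Q1 (-1) 1 1 (invr_neq0 s1); rewrite !mulN1r !mul1r; exact.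
- have := E _ Q2 1 (-1) 1 (invr_neq0 s2); rewrite !mulN1r !mul1r; exact.
- have := E _ Q3 1 1 (-1) (invr_neq0 s3); rewrite !mulN1r !mul1r; exact.
Qed.

End Trilinears.

(** * Contact points of a Poncelet triangle *)

Section Poncelet.
Variable R : realType.
Implicit Types P O t p : R * R.

(** Pairing [t1] with the barycentric relation gives the equation. The sign comes from
    Cauchy-Schwarz between [t1] and [t2], the latter being the contact point on the side [p3 p1]. *)
Lemma contact_weight_gt0 (E : ellipse R) p1 p2 p3 t1 t2 a b c s :
  a * p1.1 + b * p2.1 + c * p3.1 = 0 -> a * p1.2 + b * p2.2 + c * p3.2 = 0 ->
  a + b + c = 1 -> 0 < s ->
  t2.1 = (1 - s) * p3.1 + s * p1.1 -> t2.2 = (1 - s) * p3.2 + s * p1.2 ->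
  polar E t1 t1 = 1 -> polar E t2 t2 = 1 ->
  polar E t1 p2 = 1 -> polar E t1 p3 = 1 ->
  a * (1 - polar E t1 p1) = 1 /\ 0 < a.
Proof.
move=> w1 w2 abc s0 e1 e2 h1 h2 h12 h13.
have := polar_lincomb3 E t1 w1 w2; rewrite h12 h13 => hl.
have := polar_le1 h1 h2; rewrite (polar_lincomb E t1 e1 e2) h13 => hle.
have l1 : 0 <= 1 - polar E t1 p1.
  by rewrite -(pmulr_rge0 _ s0); lra.
have al : a * (1 - polar E t1 p1) = 1.
  transitivity (a + b + c - (a * polar E t1 p1 + b * 1 + c * 1)); first by ring.
  by rewrite hl abc subr0.
split=> //; rewrite ltNge; apply/negP => a0.
by have := mulr_le0_ge0 a0 l1; rewrite al ler10.
Qed.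

Lemma poncelet_weights (E E' : ellipse R) O P1 P2 P3 :
  ecenter E = O -> ecenter E' = O -> curve E' `<=` inside E ->
  poncelet_triangle E E' P1 P2 P3 ->
  exists a b c : R,
    [/\ orient P2 P3 O = a * orient P1 P2 P3, orient P3 P1 O = b * orient P1 P2 P3,
        orient P1 P2 O = c * orient P1 P2 P3, a + b + c = 1
      & [/\ 0 < a, 0 < b, 0 < c &
          orient P1 P2 P3 ^+ 2 * ((b + c - a) * (c + a - b) * (a + b - c)) =
          4 * (semi1 E' * semi2 E') ^+ 2]].
Proof.
move=> hE hE' hin [ o0 [c1 c2 c3] [T1 T2 T3]].
have P23 : P2 <> P3.
  by move=> e; case/eqP: o0; rewrite e /orient; ring.
have P31 : P3 <> P1.
  by move=> e; case/eqP: o0; rewrite e /orient; ring.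
have P12 : P1 <> P2.
  by move=> e; case/eqP: o0; rewrite e /orient; ring.
have [t1 [s1 [s10 _ t11 t12 [q1 q12 q13]]]] := tangent_contact hE hE' hin P23 c2 c3 T1.
have [t2 [s2 [s20 _ t21 t22 [q2 q23 q21]]]] := tangent_contact hE hE' hin P31 c3 c1 T2.
have [t3 [s3 [s30 _ t31 t32 [q3 q31 q32]]]] := tangent_contact hE hE' hin P12 c1 c2 T3.
pose o := orient P1 P2 P3.
have od (x : R) : x = x / o * o by rewrite divfK.
exists (orient P2 P3 O / o), (orient P3 P1 O / o), (orient P1 P2 O / o).
rewrite -!od; have abc : orient P2 P3 O / o + orient P3 P1 O / o + orient P1 P2 O / o = 1.
  by rewrite -!mulrDl orient_sum divff.
have w : weights P1 P2 P3 O (orient P2 P3 O / o) (orient P3 P1 O / o) (orient P1 P2 O / o).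
  rewrite ![_ / o]mulrC; exact/weightsZ/weights_orient.
move: (orient P2 P3 O / o) (orient P3 P1 O / o) (orient P1 P2 O / o) abc w => a b c abc w.
have wc := weights_cross w; rewrite abc mul1r in wc.
case: w => w1 w2.
have rot (x y z : R) : x + y + z = 0 -> y + z + x = 0 by move=> <-; ring.
have rot1 (x y z : R) : x + y + z = 1 -> y + z + x = 1 by move=> <-; ring.
have [al a0] := contact_weight_gt0 w1 w2 abc s20 t21 t22 q1 q2 q12 q13.
have [bl b0] := contact_weight_gt0 (rot _ _ _ w1) (rot _ _ _ w2) (rot1 _ _ _ abc)
  s30 t31 t32 q2 q3 q23 q21.
have [cl c0] := contact_weight_gt0 (rot _ _ _ (rot _ _ _ w1)) (rot _ _ _ (rot _ _ _ w2))
  (rot1 _ _ _ (rot1 _ _ _ abc)) s10 t11 t12 q3 q1 q31 q32.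
split=> //; split=> //.
pose m := semi1 E' * semi2 E'; have m0 : 0 < m := semi_prod_gt0 E'.
have k0 : cross (P1 - O) (P2 - O) != 0 by rewrite wc; apply: mulf_neq0 => //; exact: lt0r_neq0.
(* The contact points have the same weights at O as the vertices, since their
   weighted sum is polar-orthogonal to P1 - O and P2 - O. *)
pose v : R * R := (a * t1.1 + b * t2.1 + c * t3.1, a * t1.2 + b * t2.2 + c * t3.2).
have vE p : polar E' v p = a * polar E' t1 p + b * polar E' t2 p + c * polar E' t3 p.
  by rewrite /polar /v /=; ring.
have v1 : polar E' v (P1 - O) = 0.
  rewrite vE q21 q31.
  transitivity (a + b + c - a * (1 - polar E' t1 (P1 - O))); first by ring.
  by rewrite al abc subrr.
have v2 : polar E' v (P2 - O) = 0.
  rewrite vE q12 q32.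
  transitivity (a + b + c - b * (1 - polar E' t2 (P2 - O))); first by ring.
  by rewrite bl abc subrr.
have vw u : cross v u = 0.
  apply: (mulIf k0); rewrite -(polar_det E') v1 v2; ring.
have e1 : a * t1.1 + b * t2.1 + c * t3.1 = 0.
  by have := vw (0, 1); rewrite /cross /= mulr1 mulr0 subr0.
have e2 : a * t1.2 + b * t2.2 + c * t3.2 = 0.
  by have := vw (1, 0); rewrite /cross /= mulr1 mulr0 sub0r => /eqP; rewrite oppr_eq0 => /eqP.
have := polar_heron q1 q2 q3 e1 e2; rewrite abc mul1r -/m => heron.
have := polar_det E' t1 t2 (P1 - O) (P2 - O); rewrite q12 q21 wc -/m -/o => hdet.
(* By [al] and [bl] the determinant in [hdet], times [a b], is [(1 - a) (1 - b) - a b = c], up to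
   [m ^+ 2]. This ties the contact triangle to the area of [P1 P2 P3]. *)
have hX : cross t1 t2 * o * a * b = m ^+ 2.
  apply: (mulfI (lt0r_neq0 c0)).
  transitivity (a * b * (cross t1 t2 * (c * o))); first by ring.
  rewrite -hdet.
  transitivity ((a * polar E' t1 (P1 - O) * (b * polar E' t2 (P2 - O)) - a * b) * m ^+ 2); first by ring.
  have -> : a * polar E' t1 (P1 - O) = a - 1.
    by transitivity (a - a * (1 - polar E' t1 (P1 - O))); [ring|rewrite al].
  have -> : b * polar E' t2 (P2 - O) = b - 1.
    by transitivity (b - b * (1 - polar E' t2 (P2 - O))); [ring|rewrite bl].
  have -> : c = 1 - a - b by rewrite -abc; ring.
  by ring.
apply: (mulfI (_ : m ^+ 2 != 0)); first by rewrite expf_neq0 ?gt_eqF.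
rewrite mulrCA heron.
transitivity (4 * (cross t1 t2 * o * a * b) ^+ 2); first by rewrite -/o; ring.
by rewrite hX; ring.
Qed.

End Poncelet.

(** * Elimination and conclusion *)

Lemma eq_of_sqrM (R : realType) (x y k : R) : 0 <= x -> 0 <= y -> k != 0 ->
  x ^+ 2 * k = y ^+ 2 * k -> x = y.
Proof.
by move=> x0 y0 k0 /(mulIf k0) /eqP; rewrite eqrXn2// => /eqP.
Qed.

(** If one of the numbers were nonpositive, the pairwise sums would make the other two positive and
    the product nonpositive. *)
Lemma all_gt0_of_prod (R : realType) (x y z : R) :
  0 < x + y -> 0 < y + z -> 0 < z + x -> 0 < x * y * z ->
  [/\ 0 < x, 0 < y & 0 < z].
Proof.
have pos (u v w : R) : 0 < u + v -> 0 < v + w -> 0 < w + u -> 0 < u * v * w -> 0 < u.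
  move=> uv vw wu h; rewrite ltNge; apply/negP => u0.
  have v0 : 0 < v by lra.
  have w0 : 0 < w by lra.
  by move: h; rewrite ltNge -mulrA mulr_le0_ge0// ltW// mulr_gt0.
move=> xy yz zx h; split; first exact: pos xy yz zx h.
- by apply: pos yz zx xy _; rewrite mulrC mulrA.
- by apply: pos zx xy yz _; rewrite -mulrA mulrC.
Qed.

Lemma inv_sum_semi (R : realType) (x y z M m o : R) : x + y + z = 1 ->
  0 < x -> 0 < y -> 0 < z -> 0 < M -> 0 < m -> o != 0 ->
  16 * M ^+ 2 * (x * y * z) = ((y + z) * (z + x) * (x + y)) ^+ 2 * o ^+ 2 ->
  o ^+ 2 * (x * y * z) = 4 * m ^+ 2 ->
  x^-1 + y^-1 + z^-1 = 1 + 2 * M / m.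
Proof.
move=> s x0 y0 z0 M0 m0 o0 hM hm.
(* The product of [hM] and [hm] is a relation between squares of nonnegative numbers, once [o ^+ 2]
   is cancelled. *)
have e : 2 * M * (x * y * z) = m * ((y + z) * (z + x) * (x + y)).
  apply: (@eq_of_sqrM _ _ _ (o ^+ 2)).
  - by rewrite !mulr_ge0 ?ltW.
  - by rewrite !mulr_ge0 ?addr_ge0 ?ltW.
  - by rewrite expf_neq0.
  transitivity (4 * M ^+ 2 * (x * y * z) * (o ^+ 2 * (x * y * z))); first by ring.
  rewrite hm.
  transitivity (16 * M ^+ 2 * (x * y * z) * m ^+ 2); first by ring.
  by rewrite hM; ring.
have q : (y + z) * (z + x) * (x + y) = x * y + y * z + z * x - x * y * z.
  have -> : x * y + y * z + z * x = (x * y + y * z + z * x) * (x + y + z) by rewrite s mulr1.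
  by ring.
have -> : 2 * M / m = ((y + z) * (z + x) * (x + y)) / (x * y * z).
  apply/(canLR (mulfK (lt0r_neq0 m0))); rewrite mulrAC.
  apply/(canRL (mulfK (lt0r_neq0 (mulr_gt0 (mulr_gt0 x0 y0) z0)))).
  by rewrite e mulrC.
by rewrite q; field; rewrite !gt_eqF.
Qed.

Theorem theorem1 (R : realType) (O : R * R) (E E' : ellipse R)
    (hE : ecenter E = O) (hE' : ecenter E' = O)
    (hin : curve E' `<=` inside E)
    (hper : poncelet_3periodic E E') :
  exists S : R, forall P1 P2 P3 : R * R, poncelet_triangle E E' P1 P2 P3 ->
    (exists C1 C2 C3 : ellipse R,
       anticevian_circumellipses P1 P2 P3 O C1 C2 C3) /\
    (forall C1 C2 C3 : ellipse R,
       anticevian_circumellipses P1 P2 P3 O C1 C2 C3 ->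
       (area C1 + area C2 + area C3)%E = S%:E).
Proof.
pose M := semi1 E * semi2 E; pose m := semi1 E' * semi2 E'.
exists (M * (1 + 2 * M / m) * fine (disc_area R)) => P1 P2 P3 T.
have [a [b [c [ha hb hc abc [a0 b0 c0 hm]]]]] := poncelet_weights hE hE' hin T.
have [ o0 [c1 c2 c3] _] := T.
pose o := orient P1 P2 P3.
have M0 : 0 < M := semi_prod_gt0 E.
have m0 : 0 < m := semi_prod_gt0 E'.
have w : weights P1 P2 P3 O a b c.
  have := weightsZ o^-1 (weights_orient P1 P2 P3 O).
  by rewrite ha hb hc -/o ![_ * o]mulrC !mulKf.
(* The pairwise sums are [2 a], [2 b], [2 c], and [hm] makes the product positive. *)
have [X0 Y0 Z0] :
    [/\ 0 < b + c - a, 0 < c + a - b & 0 < a + b - c].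
  apply: all_gt0_of_prod; try lra.
  have o20 : 0 < o ^+ 2 by rewrite exprn_even_gt0.
  by rewrite -(pmulr_rgt0 _ o20) hm mulr_gt0// exprn_gt0.
have XYZ0 : 0 < (b + c - a) * (c + a - b) * (a + b - c) by rewrite !mulr_gt0.
have hM : M ^+ 2 * ((b + c - a) * (c + a - b) * (a + b - c)) =
    4 * a ^+ 2 * b ^+ 2 * c ^+ 2 * o ^+ 2.
  have := circumellipse_semi w (And4 hE c1 c2 c3).
  by rewrite abc expr1n mulr1.
split.
  have [|||Q1 [Q2 [Q3 aQ]]] := anticevian_exists o0 ha hb hc.
  - by rewrite gt_eqF//; lra.
  - by rewrite gt_eqF//; lra.
  - by rewrite gt_eqF//; lra.
  have [w1 w2 w3] := anticevian_weights o0 ha hb hc aQ.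
  have [||||C1 h1] := circumellipse_exists w1 _ _ _ _ o0;
    rewrite ?oppr_eq0 ?gt_eqF//.
    (* Negating one weight permutes the four Heron factors up to two sign changes that cancel. *)
    by move: XYZ0; rewrite -[ltRHS]mulr1 -abc; congr (0 < _); ring.
  have [||||C2 h2] := circumellipse_exists w2 _ _ _ _ o0;
    rewrite ?oppr_eq0 ?gt_eqF//.
    by move: XYZ0; rewrite -[ltRHS]mulr1 -abc; congr (0 < _); ring.
  have [||||C3 h3] := circumellipse_exists w3 _ _ _ _ o0;
    rewrite ?oppr_eq0 ?gt_eqF//.
    by move: XYZ0; rewrite -[ltRHS]mulr1 -abc; congr (0 < _); ring.
  by exists C1, C2, C3, Q1, Q2, Q3.
move=> C1 C2 C3 [Q1 [Q2 [Q3 [aQ h1 h2 h3]]]].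
have [w1 w2 w3] := anticevian_weights o0 ha hb hc aQ.
(* With the weight [a] negated, the sum of the weights is [b + c - a] and one Heron factor becomes
   [a + b + c = 1]; dividing by [hM] leaves an equality of squares. *)
have s1 : semi1 C1 * semi2 C1 * (b + c - a) = M.
  apply: (eq_of_sqrM _ (ltW M0) (lt0r_neq0 XYZ0)).
    by rewrite mulr_ge0 ?(ltW (semi_prod_gt0 _)) ?ltW.
  rewrite hM; have := circumellipse_semi w1 h1; rewrite -/o sqrrN => <-.
  have -> : - a + b + c = b + c - a by ring.
  have -> : b + c - - a = 1 by rewrite -abc; ring.
  by ring.
have s2 : semi1 C2 * semi2 C2 * (c + a - b) = M.
  apply: (eq_of_sqrM _ (ltW M0) (lt0r_neq0 XYZ0)).
    by rewrite mulr_ge0 ?(ltW (semi_prod_gt0 _)) ?ltW.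
  rewrite hM; have := circumellipse_semi w2 h2; rewrite -/o sqrrN => <-.
  have -> : a - b + c = c + a - b by ring.
  have -> : c + a - - b = 1 by rewrite -abc; ring.
  by ring.
have s3 : semi1 C3 * semi2 C3 * (a + b - c) = M.
  apply: (eq_of_sqrM _ (ltW M0) (lt0r_neq0 XYZ0)).
    by rewrite mulr_ge0 ?(ltW (semi_prod_gt0 _)) ?ltW.
  rewrite hM; have := circumellipse_semi w3 h3; rewrite -/o sqrrN => <-.
  have -> : a + b - - c = 1 by rewrite -abc; ring.
  by ring.
have inv : (b + c - a)^-1 + (c + a - b)^-1 + (a + b - c)^-1 = 1 + 2 * M / m.
  apply: (@inv_sum_semi _ _ _ _ M m o) => //; first by rewrite -abc; ring.
  transitivity (16 * (M ^+ 2 * ((b + c - a) * (c + a - b) * (a + b - c)))); first by ring.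
  by rewrite hM; ring.
rewrite !area_ellipse -(fineK (disc_area_fin R)) -!EFinM -!EFinD -inv; congr EFin.
rewrite -!mulrDl; congr (_ * _).
rewrite !mulrDr -{1}s1 -{1}s2 -s3.
by rewrite !mulfK ?gt_eqF.
Qed.
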